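(* Fix constants $\delta>0$, $0<\epsilon<1/2$ and a positive integer $\Delta$. There exist a constant $C$ depending only on $\Delta$, $\delta$ (and the fixed noise parameter $\epsilon$) and a function $\eta(n)\to 0$ as $n\to\infty$ (depending only on $\delta,\epsilon,\Delta$) such that the following holds. Let $G$ be a $\delta$-excellent expander on $n$ vertices with maximum degree at most $\Delta$. Then in the noisy corruption detection game on $G$ with noise parameter $\epsilon$ there is a strategy for the player making at most $Cn$ queries such that, for every partition $V(G)=T\sqcup B$ into truthful vertices $T$ and corrupt vertices $B$ with $|T|=(\frac12+\delta)n$, and for every behaviour of the corrupt vertices, with probability at least $1-\eta(n)$ the player outputs sets $T',B'\subseteq V(G)$ with $$|T\,\Delta\,T'|\le 6\delta n\quad\text{and}\quad |B\,\Delta\,B'|\le 6\delta n .$$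
   Context: Noisy corruption detection game with noise parameter $\epsilon$: a finite simple connected graph $G$ on $n$ vertices is known to the player, and $V(G)=T\sqcup B$ is a partition, unknown to the player, into truthful vertices $T$ and corrupt vertices $B$. A query consists of choosing an ordered pair $(u,v)$ of adjacent vertices and asking $u$ whether its neighbor $v$ is truthful or corrupt; the same pair may be queried many times, and the answers may differ. Each time a truthful vertex $u$ is queried, it gives the correct answer with probability $1-\epsilon$ and the incorrect answer with probability $\epsilon$, independently over all queries. Corrupt vertices answer adversarially (arbitrarily). The strategy is only required to be bounded in the number of queries, not in computation time. The player knows $\delta$ and $\epsilon$. $A\,\Delta\,A'$ denotes symmetric difference. A $\delta$-excellent expander is a graph $G$ on $n$ vertices such that any two disjoint subsets of $V(G)$, each of size at least $\delta n$, have an edge between them. *)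

(* Defs.v *)
From mathcomp Require Import all_boot all_order all_algebra.
From mathcomp Require Import all_classical all_reals all_analysis.

Set Implicit Arguments.
Unset Strict Implicit.
Unset Printing Implicit Defensive.

Import Order.TTheory GRing.Theory Num.Theory.
Local Open Scope ring_scope.

Record sgraph := SGraph {
  vertex :> finType;
  edge : rel vertex;
  edge_sym : symmetric edge;
  edge_irrefl : irreflexive edge }.

Definition connected_graph (G : sgraph) : Prop :=
  forall x y : G, connect (@edge G) x y.

Definition max_degree_le (G : sgraph) (D : nat) : Prop :=
  forall x : G, (#|[set y | edge x y]| <= D)%N.

Definition excellent_expander (R : realType) (delta : R) (G : sgraph) : Prop :=
  forall X Y : {set G}, [disjoint X & Y] ->
    delta * #|G|%:R <= #|X|%:R -> delta * #|G|%:R <= #|Y|%:R ->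
    exists x y : G, [/\ x \in X, y \in Y & edge x y].

Definition symdiff (T : finType) (X Y : {set T}) : {set T} :=
  (X :\: Y) :|: (Y :\: X).

(* An adaptive strategy is a decision tree: [Ask u v _ k] asks [u] about its
   neighbour [v] and goes on with [k true] if the answer is "truthful", with
   [k false] if it is "corrupt"; [Output T' B'] ends the game. *)
Inductive strategy (G : sgraph) : Type :=
| Output of {set G} & {set G}
| Ask (u v : G) of edge u v & (bool -> strategy G).

Fixpoint max_queries (G : sgraph) (s : strategy G) : nat :=
  match s with
  | Output _ _ => 0
  | Ask _ _ _ k => (maxn (max_queries (k true)) (max_queries (k false))).+1
  end.

(* Past queries with their answers, most recent first. *)
Definition history (G : sgraph) : Type := seq (G * G * bool).

(* [beta h u v] is the conditional probability, given the history [h], that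
   a corrupt [u] asked about [v] answers "truthful". The corrupt vertices may
   thus collude, adapt to everything that happened so far, and randomize; the
   values 0 and 1 give the deterministic adversaries. *)
Definition behaviour (R : realType) (G : sgraph) : Type :=
  history G -> G -> G -> R.

Definition valid_behaviour (R : realType) (G : sgraph)
    (beta : behaviour R G) : Prop :=
  forall h u v, 0 <= beta h u v <= 1.

(* Conditional probability, given the history [h], that [u] answers "truthful"
   when asked about [v]. For [u] in [T] it does not depend on [h]: this is the
   independence of the noise over all queries. *)
Definition answer_prob (R : realType) (eps : R) (G : sgraph) (T : {set G})
    (beta : behaviour R G) (h : history G) (u v : G) : R :=
  if u \in T then (if v \in T then 1 - eps else eps) else beta h u v.

(* Probability that the play of [s], continued from the history [h], ends with
   an output satisfying [E]. *)
Fixpoint prob_from (R : realType) (eps : R) (G : sgraph) (T : {set G})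
    (beta : behaviour R G) (E : {set G} -> {set G} -> bool)
    (h : history G) (s : strategy G) : R :=
  match s with
  | Output T' B' => if E T' B' then 1 else 0
  | Ask u v _ k =>
      let p := answer_prob eps T beta h u v in
      p * prob_from eps T beta E ((u, v, true) :: h) (k true)
      + (1 - p) * prob_from eps T beta E ((u, v, false) :: h) (k false)
  end.

Definition output_prob (R : realType) (eps : R) (G : sgraph) (T : {set G})
    (beta : behaviour R G) (s : strategy G)
    (E : {set G} -> {set G} -> bool) : R :=
  prob_from eps T beta E [::] s.

(* Main.v *)
(** Every ordered edge is queried [k] times and the majority answer is kept.
    For [x = 1 / (2 eps)] a truthful answer multiplies [x ^ (wrong - right)] by a
    factor of mean [1/2 + 2 eps (1 - eps) < 1], so [\prod_e (1 + y x ^ (wrong - right))]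
    over the truthful edges, with the remaining answers replaced by their mean
    factors, is a martingale against every adaptive adversary. For [k] large
    Markov's inequality shows that, outside an event of probability at most
    [(3/4) ^ n], at most [delta n / 2] truthful edges have a misleading majority.

    The player then outputs any set [T'] of size at least [(1/2 + delta) n] with
    which the majority answers of all but [delta n / 2] of its members agree; [T] is
    such a set. Two such sets share at least [2 delta n] vertices, hence at least
    [delta n] vertices consistent with both; no edge joins these to the symmetric
    difference, which the expander property then makes smaller than [delta n]. *)
Require Import Defs.
From mathcomp Require Import all_boot all_order all_algebra.
From mathcomp Require Import all_classical all_reals all_analysis.
From mathcomp Require Import ring lra.

Set Implicit Arguments.
Unset Strict Implicit.
Unset Printing Implicit Defensive.

Import Order.TTheory GRing.Theory Num.Theory.
Import numFieldNormedType.Exports.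
Local Open Scope classical_set_scope.
Local Open Scope ring_scope.

(** * The fixed query schedule and the decoding rule *)

Definition query (G : sgraph) : finType := {e : G * G | edge e.1 e.2}.

Definition asker (G : sgraph) (q : query G) : G := (val q).1.

Definition asked (G : sgraph) (q : query G) : G := (val q).2.

Fixpoint ask_all (G : sgraph) (F : history G -> {set G} * {set G})
    (qs : seq (query G)) (h : history G) : strategy G :=
  match qs with
  | [::] => Output (F h).1 (F h).2
  | q :: qs' => Ask (valP q : edge (asker q) (asked q))
      (fun b => ask_all F qs' ((asker q, asked q, b) :: h))
  end.

Definition repeated_queries (G : sgraph) (k : nat) : seq (query G) :=
  flatten (nseq k (enum (query G))).

Definition answer_count (G : sgraph) (h : history G) (u v : G) (b : bool) : nat :=
  count_mem (u, v, b) h.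

Definition majority (G : sgraph) (h : history G) (u v : G) : bool :=
  (answer_count h u v false < answer_count h u v true)%N.

(** Ties count as misleading whatever the truth is, although [majority] resolves them to [false]. *)
Definition misleading (G : sgraph) (T : {set G}) (h : history G) (q : query G) : bool :=
  (asker q \in T) &&
  (answer_count h (asker q) (asked q) (asked q \in T)
     <= answer_count h (asker q) (asked q) (asked q \notin T))%N.

(* [p.2] is a guess for the truthful set, [p.1] the part of it whose majority
   answers all agree with this guess. *)
Definition plausible (R : realType) (delta : R) (G : sgraph) (h : history G)
    (p : {set G} * {set G}) : bool :=
  [&& p.1 \subset p.2,
      (2^-1 + delta) * #|G|%:R <= #|p.2|%:R,
      #|p.2 :\: p.1|%:R <= delta / 2 * #|G|%:R &
      [forall u in p.1, forall v, edge u v ==> (majority h u v == (v \in p.2))]].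

(** The default [set0] is harmless: it occurs only when no pair is plausible, hence only if too many
    answers mislead. *)
Definition guess (R : realType) (delta : R) (G : sgraph) (h : history G) :
    {set G} * {set G} :=
  let T' := if [pick p | plausible delta h p] is Some p then p.2 else finset.set0 in
  (T', ~: T').

Lemma max_queries_ask_all (G : sgraph) F (qs : seq (query G)) h :
  max_queries (ask_all F qs h) = size qs.
Proof. by elim: qs h => //= q qs IH h; rewrite !IH maxnn. Qed.

Lemma size_repeated_queries (G : sgraph) (k : nat) :
  size (repeated_queries G k) = (k * #|query G|)%N.
Proof. by rewrite size_flatten /shape map_nseq sumn_nseq -cardE mulnC. Qed.

Lemma count_repeated_queries (G : sgraph) (k : nat) (q : query G) :
  count_mem q (repeated_queries G k) = k.
Proof.
rewrite count_flatten map_nseq sumn_nseq count_uniq_mem ?enum_uniq //.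
by rewrite mem_enum mul1n.
Qed.

Lemma card_query (G : sgraph) (D : nat) :
  max_degree_le G D -> (#|query G| <= D * #|G|)%N.
Proof.
move=> degG; rewrite card_sig -sum1_card.
rewrite -(pair_big_dep xpredT (fun u v => edge u v) (fun _ _ => 1%N)) /=.
rewrite mulnC -sum_nat_const; apply: leq_sum => u _.
by rewrite sum1dep_card; apply: degG.
Qed.

Lemma symdiffC (T : finType) (X Y : {set T}) : symdiff (~: X) (~: Y) = symdiff X Y.
Proof.
by apply/finset.setP => x; rewrite !inE; case: (x \in X); case: (x \in Y).
Qed.

(** * Plausible sets: closeness to each other and plausibility of the truth *)

Section Plausible.
Variables (R : realType) (delta : R) (G : sgraph) (h : history G).

(* A vertex lying in both consistent parts gives the same answers under both
   guesses, so none of its neighbours is in the symmetric difference. *)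
Lemma plausible_close (p1 p2 : {set G} * {set G}) :
  excellent_expander delta G -> plausible delta h p1 -> plausible delta h p2 ->
  #|symdiff p1.2 p2.2|%:R <= delta * #|G|%:R.
Proof.
case: p1 p2 => [S1 T1] [S2 T2] exG /and4P[/= sub1 big1 diff1 /'forall_implyP ok1].
move=> /and4P[/= sub2 big2 diff2 /'forall_implyP ok2].
rewrite leNgt; apply/negP => /ltW bigD.
have dis : [disjoint S1 :&: S2 & symdiff T1 T2]%B.
  rewrite -finset.setI_eq0; apply/eqP/finset.setP => x; rewrite !inE.
  apply/negP => /andP[/andP[x1 x2]].
  by rewrite (fintype.subsetP sub1 _ x1) (fintype.subsetP sub2 _ x2).
have bigS : delta * #|G|%:R <= #|S1 :&: S2|%:R.
  have sub : T1 :&: T2 \subset (S1 :&: S2) :|: ((T1 :\: S1) :|: (T2 :\: S2)).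
    apply/fintype.subsetP => x; rewrite !inE => /andP[-> ->].
    by case: (x \in S1); case: (x \in S2).
  have leI := leq_trans (subset_leq_card sub) (leq_card_setU _ _).
  have {leI} := leq_trans leI (leq_add (leqnn _) (leq_card_setU _ _)).
  have := cardsUI T1 T2; have := max_card (mem (T1 :|: T2)).
  rewrite -!(ler_nat R) !natrD => maxU /(congr1 (fun n : nat => n%:R : R)).
  rewrite !natrD; lra.
have [u [v [uS vD uv]]] := exG _ _ dis bigS bigD.
move: uS vD; rewrite !inE => /andP[u1 u2].
have /forallP/(_ v) := ok1 u u1; have /forallP/(_ v) := ok2 u u2.
by rewrite uv /= => /eqP <- /eqP <-; case: (majority h u v).
Qed.

Lemma guess_close (T : {set G}) :
  excellent_expander delta G -> (exists S, plausible delta h (S, T)) ->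
  #|symdiff T (guess delta h).1|%:R <= delta * #|G|%:R.
Proof.
move=> exG [S okT]; rewrite /guess /=; case: pickP => [p okp|none].
  exact: (plausible_close exG okT okp).
by rewrite none in okT.
Qed.

Lemma plausible_truth (T : {set G}) :
  (2^-1 + delta) * #|G|%:R <= #|T|%:R ->
  #|[set q | misleading T h q]%SET|%:R <= delta / 2 * #|G|%:R ->
  exists S, plausible delta h (S, T).
Proof.
move=> bigT few.
pose S := [set u in T | [forall v, edge u v ==> (majority h u v == (v \in T))]]%SET.
exists S; apply/and4P; split => //=.
- by apply/fintype.subsetP => u; rewrite inE => /andP[].
(* Each vertex of [T :\: S] asks some misleading query, so [asker] maps the misleading queries onto
   a superset of [T :\: S]. *)
- apply: le_trans few; rewrite ler_nat.
  apply: leq_trans (leq_imset_card (@asker G) _); apply/subset_leq_card/fintype.subsetP => u.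
  rewrite !inE => /andP[+ uT]; rewrite uT /= negb_forall => /existsP[v].
  rewrite negb_imply => /andP[uv wrong].
  pose q : query G := Sub (u, v) uv.
  apply/imsetP; exists q => //; rewrite inE /misleading /asker /asked /= uT /=.
  by move: wrong; rewrite /majority; case: (v \in T);
    rewrite /= ?eqb_id ?eqbF_neg ?negbK -?leqNgt // => /ltnW.
- by apply/'forall_implyP => u; rewrite inE => /andP[].
Qed.

End Plausible.

(** * The exponential potential and its martingale property *)

Section Potential.
Variables (R : realType) (eps : R) (G : sgraph) (T : {set G}).
Hypotheses (eps_gt0 : 0 < eps) (eps_lt2V : eps < 2^-1).

(** The mean factor [eps * x + (1 - eps) / x] is below 1 exactly for [x] strictly between 1 and
    [(1 - eps) / eps]; this value lies there. *)
Definition tilt : R := (2 * eps)^-1.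

(* Mean factor by which one truthful answer multiplies [tilt ^ (wrong - right)]. *)
Definition decay : R := 2^-1 + 2 * eps * (1 - eps).

Lemma decayE : decay = eps * tilt + (1 - eps) / tilt.
Proof. by rewrite /decay /tilt invrK; field; rewrite gt_eqF. Qed.

Lemma decay_ge0 : 0 <= decay.
Proof.
have e0 := eps_gt0; have e1 := eps_lt2V.
have : 0 <= eps * (1 - eps) by apply: mulr_ge0; lra.
by rewrite /decay; lra.
Qed.

Lemma decay_lt1 : decay < 1.
Proof.
have e0 := eps_gt0; have e1 := eps_lt2V.
(* [decay] equals [1 - 2 * (2^-1 - eps) ^+ 2]. *)
have : 0 < (2^-1 - eps) * (2^-1 - eps) by apply: mulr_gt0; lra.
by rewrite /decay; lra.
Qed.

Lemma tilt_ge1 : 1 <= tilt.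
Proof. by have e0 := eps_gt0; have e1 := eps_lt2V; rewrite /tilt invf_ge1; lra. Qed.

Definition edge_weight (h : history G) (q : query G) : R :=
  tilt ^+ answer_count h (asker q) (asked q) (asked q \notin T) /
  tilt ^+ answer_count h (asker q) (asked q) (asked q \in T).

(* Conditional expectation, given the history [h] and with the queries [qs]
   still to be asked, of the final value of [\prod_q (1 + y * edge_weight _ q)]. *)
Definition potential (y : R) (qs : seq (query G)) (h : history G) : R :=
  \prod_(q : query G | asker q \in T)
    (1 + y * (edge_weight h q * decay ^+ count_mem q qs)).

Lemma edge_weight_ge0 h q : 0 <= edge_weight h q.
Proof. by have t1 := tilt_ge1; rewrite /edge_weight divr_ge0 ?exprn_ge0 //; lra. Qed.

Lemma edge_weight_other h q q' b :
  q' != q -> edge_weight ((asker q, asked q, b) :: h) q' = edge_weight h q'.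
Proof.
move=> neq; rewrite /edge_weight /answer_count /=.
have ne b' : ((asker q, asked q, b) == (asker q', asked q', b')) = false.
  apply/negP => /eqP[e1 e2 _]; case/negP: neq; apply/eqP/val_inj.
  by rewrite [LHS]surjective_pairing [RHS]surjective_pairing -/(asker q) -/(asker q') e1
     -/(asked q) -/(asked q') e2.
by rewrite !ne !add0n.
Qed.

Lemma edge_weight_same h q b :
  edge_weight ((asker q, asked q, b) :: h) q =
  (if b == (asked q \in T) then tilt^-1 else tilt) * edge_weight h q.
Proof.
have t1 := tilt_ge1; have tN0 : tilt != 0 by rewrite gt_eqF //; lra.
rewrite /edge_weight /answer_count /= !xpair_eqE !eqxx /=.
by case: b; case: (asked q \in T) => /=; rewrite ?add0n ?add1n ?exprS;
  field; rewrite ?expf_neq0.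
Qed.

(** A truthful asker affects only the factor of [q], which is affine in its weight, so averaging
    multiplies that weight by [decay]. A corrupt asker affects no factor, so its answer probability
    cancels. *)
Lemma potential_ask (y : R) (beta : behaviour R G) q qs h :
  let p := answer_prob eps T beta h (asker q) (asked q) in
  p * potential y qs ((asker q, asked q, true) :: h)
  + (1 - p) * potential y qs ((asker q, asked q, false) :: h)
  = potential y (q :: qs) h.
Proof.
move=> p; rewrite /potential.
have [qT|qNT] := boolP (asker q \in T).
  rewrite !(bigD1 q qT) /= eqxx !edge_weight_same.
  have rest b : \prod_(i | (asker i \in T) && (i != q))
      (1 + y * (edge_weight ((asker q, asked q, b) :: h) i * decay ^+ count_mem i qs))
    = \prod_(i | (asker i \in T) && (i != q))
      (1 + y * (edge_weight h i * decay ^+ ((q == i) + count_mem i qs))).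
    apply: eq_bigr => i /andP[_ iq].
    by rewrite edge_weight_other // eq_sym (negbTE iq) add0n.
  rewrite !rest add1n exprS /p /answer_prob qT.
  set d := decay ^+ _; set P := \prod_(i | _) _; rewrite decayE.
  by case: (asked q \in T) => /=; ring.
have rest b : \prod_(i | asker i \in T)
      (1 + y * (edge_weight ((asker q, asked q, b) :: h) i * decay ^+ count_mem i qs))
    = \prod_(i | asker i \in T)
      (1 + y * (edge_weight h i * decay ^+ ((q == i) + count_mem i qs))).
  apply: eq_bigr => i iT.
  have iq : i != q by apply: contraNneq qNT => <-.
  by rewrite edge_weight_other // eq_sym (negbTE iq) add0n.
by rewrite /= !rest; ring.
Qed.

Lemma answer_prob_itv (beta : behaviour R G) h u v :
  valid_behaviour beta -> 0 <= answer_prob eps T beta h u v <= 1.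
Proof.
have e0 := eps_gt0; have e1 := eps_lt2V.
move=> okb; rewrite /answer_prob; case: ifP => _; last exact: okb.
by case: ifP => _; apply/andP; split; lra.
Qed.

(** Markov's inequality by induction on the decision tree, with [a] the inverse threshold: at a
    failing leaf the left side is at most 0, and [potential_ask] carries the bound through each
    query. *)
Lemma prob_ask_all_ge (y a : R) (beta : behaviour R G)
    (F : history G -> {set G} * {set G}) (E : {set G} -> {set G} -> bool) qs h :
  valid_behaviour beta -> 0 <= a -> 0 <= y ->
  (forall h', E (F h').1 (F h').2 \/ 1 <= a * potential y [::] h') ->
  1 - a * potential y qs h <= prob_from eps T beta E h (ask_all F qs h).
Proof.
move=> okb a0 y0 okF; elim: qs h => [|q qs IH] h.
  have P0 : 0 <= a * potential y [::] h.
    apply: mulr_ge0 => //; apply: prodr_ge0 => i _; apply: addr_ge0 => //.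
    by apply: mulr_ge0 => //; apply: mulr_ge0;
      rewrite ?edge_weight_ge0 ?exprn_ge0 ?decay_ge0.
  by case: (okF h) => /= [->|]; [|case: ifP => _]; lra.
rewrite /= -(potential_ask y beta).
have /andP[p0 p1] := answer_prob_itv h (asker q) (asked q) okb.
set p := answer_prob _ _ _ _ _ _ in p0 p1 *.
have t := ler_wpM2l p0 (IH ((asker q, asked q, true) :: h)).
have p1' : 0 <= 1 - p by lra.
have f := ler_wpM2l p1' (IH ((asker q, asked q, false) :: h)).
apply: le_trans (lerD t f); rewrite le_eqVlt; apply/orP; left; apply/eqP; ring.
Qed.

Lemma potential_start (y : R) k :
  0 <= y ->
  potential y (repeated_queries G k) [::] <= (1 + y * decay ^+ k) ^+ #|query G|.
Proof.
move=> y0; have d0 : 0 <= y * decay ^+ k by rewrite mulr_ge0 ?exprn_ge0 ?decay_ge0.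
rewrite /potential (eq_bigr (fun=> 1 + y * decay ^+ k)); last first.
  by move=> q _; rewrite count_repeated_queries /edge_weight !expr0 invr1 !mul1r.
by rewrite prodr_const; apply: ler_weXn2l; [lra | apply: max_card].
Qed.

(** A misleading query has weight at least 1, as [tilt] is at least 1; every other factor is still
    at least 1. *)
Lemma potential_end (y : R) h :
  0 <= y -> (1 + y) ^+ #|[set q | misleading T h q]%SET| <= potential y [::] h.
Proof.
move=> y0; rewrite -prodr_const /potential [leRHS]big_mkcond /= big_mkcond /=.
apply: ler_prod => q _; rewrite inE /misleading expr0 mulr1.
have w0 := edge_weight_ge0 h q; have yw0 := mulr_ge0 y0 w0.
case: (asker q \in T) => /=; last by rewrite ler01 lexx.
case: ifP => [le_rw|_]; last by rewrite ler01; lra.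
rewrite addr_ge0 //= lerD2l ler_peMr // /edge_weight.
have t1 := tilt_ge1; rewrite ler_pdivlMr ?exprn_gt0 //; last lra.
by rewrite mul1r; apply: ler_weXn2l.
Qed.

End Potential.

(** * Numerical estimates *)

Lemma ex_small_expr (R : realType) (c e : R) :
  0 <= c -> c < 1 -> 0 < e -> exists k, c ^+ k < e.
Proof.
move=> c0 c1 e0; have nc : `|c| < 1 by rewrite ger0_norm.
have /cvgr0_norm_lt/(_ e e0)[N _ /(_ N (leqnn N))] := cvg_expr nc.
by rewrite /= ger0_norm ?exprn_ge0 // => ?; exists N.
Qed.

Lemma expr1D_le (R : realType) (t : R) (D : nat) :
  0 <= t -> t * D%:R <= 3^-1 -> (1 + t) ^+ D <= 3 / 2.
Proof.
move=> t0 small.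
have -> : (3 / 2 : R) = (1 - 3^-1)^-1 by field.
apply: (@le_trans _ _ (1 - t * D%:R)^-1); last first.
  by rewrite lef_pV2 ?posrE; lra.
(* The induction works because [(1 + t) * (1 - t * (D + 1))] is at most [1 - t * D]. *)
suff: (1 + t) ^+ D * (1 - t * D%:R) <= 1.
  by move=> H; rewrite -[leRHS]mul1r ler_pdivlMr //; lra.
elim: D small => [|D IH] small; first by rewrite expr0; lra.
have D0 : 0 <= D%:R :> R by [].
rewrite -natr1 in small *.
have tD0 := mulr_ge0 t0 D0.
apply: le_trans (IH _); last lra.
rewrite exprSr -mulrA ler_wpM2l ?exprn_ge0 //; nra.
Qed.

Theorem theorem3p1 (R : realType) (delta eps : R) (Delta : nat) :
  0 < delta -> 0 < eps -> eps < 2^-1 -> (0 < Delta)%N ->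
  exists (C : R) (eta : nat -> R),
    (eta n @[n --> \oo] --> (0 : R)) /\
    forall G : sgraph,
      connected_graph G ->
      excellent_expander delta G ->
      max_degree_le G Delta ->
      exists s : strategy G,
        (max_queries s)%:R <= C * #|G|%:R /\
        forall (T B : {set G}) (beta : behaviour R G),
          B = ~: T ->
          #|T|%:R = (2^-1 + delta) * #|G|%:R ->
          valid_behaviour beta ->
          1 - eta #|G| <=
            output_prob eps T beta s (fun T' B' =>
              (#|symdiff T T'|%:R <= 6 * delta * #|G|%:R) &&
              (#|symdiff B B'|%:R <= 6 * delta * #|G|%:R)).
Proof.
move=> delta0 eps0 eps2 Delta0.
(* With [1 + y = 2 ^+ m] and [m * delta / 2 > 1], more than [delta * n / 2] misleading queries force
   a final potential of at least [2 ^+ n]. *)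
have [m m_gt] : exists m : nat, (delta / 2)^-1 < m%:R.
  by exists (Num.truncn (delta / 2)^-1).+1; apply: truncnS_gt.
pose y : R := 2 ^+ m - 1.
have y0 : 0 <= y by rewrite /y subr_ge0 exprn_ege1 //; lra.
have y1 : 0 < (y + 1) * 3 * Delta%:R by rewrite !mulr_gt0 ?ltr0n //; lra.
(* This makes [y * decay eps ^+ k * Delta] at most [1 / 3]. With at most [Delta * n] ordered edges,
   the potential starts below [(3 / 2) ^+ n], or equal to it; dividing by [2 ^+ n] gives the failure
   bound [(3 / 4) ^+ n]. *)
have [k k_small] : exists k, decay eps ^+ k < ((y + 1) * 3 * Delta%:R)^-1.
  by apply: ex_small_expr; rewrite ?decay_ge0 ?decay_lt1 ?invr_gt0.
have d0 : 0 <= decay eps ^+ k by rewrite exprn_ge0 ?decay_ge0.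
have base_le : (1 + y * decay eps ^+ k) ^+ Delta <= 3 / 2.
  apply: expr1D_le; first exact: mulr_ge0.
  move: k_small; rewrite -[ltRHS]mul1r ltr_pdivlMr // => k_small.
  have : 0 <= decay eps ^+ k * Delta%:R by rewrite mulr_ge0.
  lra.
exists ((k * Delta)%:R), (fun n => (3 / 4) ^+ n); split.
  by apply: cvg_expr; rewrite ger0_norm; lra.
move=> G _ exG degG.
exists (ask_all (guess delta (G := G)) (repeated_queries G k) [::]); split.
  rewrite max_queries_ask_all size_repeated_queries -natrM ler_nat -mulnA.
  by rewrite leq_mul2l card_query ?orbT.
move=> T B beta -> cardT okb; rewrite /output_prob.
have a0 : 0 <= (2^-1 : R) ^+ #|G| by rewrite exprn_ge0 //; lra.
apply: le_trans (prob_ask_all_ge eps0 eps2 (y := y) _ _ okb a0 y0 _).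
  rewrite lerB //.
  have -> : (3 / 4 : R) = 2^-1 * (3 / 2) by field.
  rewrite exprMn ler_wpM2l //.
  apply: le_trans (potential_start _ eps0 eps2 _ y0) _.
  have b1 : 1 <= 1 + y * decay eps ^+ k by rewrite lerDl mulr_ge0.
  apply: le_trans (ler_weXn2l b1 (card_query degG)) _.
  by rewrite exprM lerXn2r ?nnegrE ?exprn_ge0 //; lra.
move=> h.
have [few|many] := leP (#|[set q | misleading T h q]%SET|%:R) (delta / 2 * #|G|%:R).
  left; have n0 : 0 <= delta * #|G|%:R by rewrite mulr_ge0 // ltW.
  rewrite [(guess _ _).2]/(~: (guess delta h).1) symdiffC andbb.
  apply: le_trans (guess_close exG _) _; last lra.
  by apply: plausible_truth => //; rewrite cardT.
right; apply: le_trans (ler_wpM2l a0 (potential_end T eps0 eps2 h y0)).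
rewrite /y addrC subrK -exprM exprVn mulrC ler_pdivlMr ?exprn_gt0 // mul1r.
apply: ler_weXn2l; first lra.
rewrite -(ler_nat R) natrM.
have d2 : 0 < delta / 2 by lra.
have : 1 <= m%:R * (delta / 2).
  by move: m_gt; rewrite -[ltLHS]mul1r ltr_pdivrMr // => /ltW.
move=> m1; apply: le_trans (ler_wpM2l (ler0n R m) (ltW many)).
by rewrite mulrA ler_peMl.
Qed.
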